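(* Let $k\in\mathcal{S}_{-1}$ be a Sonine kernel and let $\kappa\in\mathcal{S}_{-1}$ be the Sonine kernel associate to $k$. Let $\lambda\in\mathbb{R}$, $y_0\in\mathbb{R}$ and $f\in C_{-1}^1(0,+\infty)$. The initial-value problem $$\begin{cases}({}_*\mathbb{D}_{(k)}y)(t)-\lambda y(t)=f(t), & t>0,\\ y(0)=y_0,\end{cases}$$ for the fractional differential equation with the general fractional derivative of Caputo type has a unique solution $y\in C_{-1}^1(0,+\infty)$, and it can be represented in the form $$y(t)=(f*l_{\kappa,\lambda})(t)+y_0\,L_{\kappa,\lambda}(t),$$ where $l_{\kappa,\lambda}$ and $L_{\kappa,\lambda}$ are the convolution series $$l_{\kappa,\lambda}(t)=\sum_{j=1}^{+\infty}\lambda^{j-1}\kappa^j(t),\qquad L_{\kappa,\lambda}(t)=(k*l_{\kappa,\lambda})(t)=1+\Bigl(\{1\}*\sum_{j=1}^{+\infty}\lambda^j\kappa^j\Bigr)(t).$$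
   Context: $C_{-1}(0,+\infty)$ is the space of functions $f$ on $(0,+\infty)$ of the form $f(t)=t^{p-1}f_1(t)$, $t>0$, for some $p>0$ and some $f_1\in C[0,+\infty)$. $C_{-1,0}(0,+\infty)$ is the set of functions of the form $f(t)=t^{p-1}f_1(t)$, $t>0$, with some $0<p<1$ and $f_1\in C[0,+\infty)$. $f\in C_{-1}^1(0,+\infty)$ means $f'\in C_{-1}(0,+\infty)$; such a function has a finite limit $f(0):=\lim_{t\to0+}f(t)$ and is identified with its continuous extension to $[0,+\infty)$. $(f*g)(t)=\int_0^t f(\tau)g(t-\tau)\,d\tau$ is the Laplace convolution, $\kappa^j=\kappa*\cdots*\kappa$ ($j$ factors), and $\{1\}$ is the constant function equal to $1$. $\mathcal{S}_{-1}$ is the set of Sonine kernels occurring in pairs $\kappa,k\in C_{-1,0}(0,+\infty)$ with $(\kappa*k)(t)=1$ for all $t>0$; $k$ and $\kappa$ are then called associate to each other (the associate kernel is unique). The series $\sum_{j\ge1}\lambda^{j-1}\kappa^j(t)$ converges for all $t>0$ and defines a function in $C_{-1}(0,+\infty)$. The general fractional derivative of Caputo type with kernel $k$ is $({}_*\mathbb{D}_{(k)}y)(t)=\frac{d}{dt}(k*y)(t)-y(0)k(t)$, $t>0$. *)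

(* Defs.v *)
From HB Require Import structures.
From mathcomp Require Import all_boot all_order all_algebra.
From mathcomp Require Import all_classical all_reals all_analysis.

Set Implicit Arguments.
Unset Strict Implicit.
Unset Printing Implicit Defensive.

Import Order.TTheory GRing.Theory Num.Theory.
Import numFieldNormedType.Exports.

Local Open Scope classical_set_scope.
Local Open Scope ring_scope.

(* A function on (0, +oo) is represented by a total function R -> R whose
   values outside (0, +oo) are irrelevant: no definition below reads them. *)

(* C_{-1}(0, +oo) *)
Definition Cm1 (R : realType) (f : R -> R) : Prop :=
  exists (p : R) (f1 : R -> R),
    [/\ 0 < p,
        {within `[0, +oo[, continuous f1} &
        forall t : R, 0 < t -> f t = t `^ (p - 1) * f1 t].

(* C_{-1,0}(0, +oo) *)
Definition Cm10 (R : realType) (f : R -> R) : Prop :=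
  exists (p : R) (f1 : R -> R),
    [/\ 0 < p < 1,
        {within `[0, +oo[, continuous f1} &
        forall t : R, 0 < t -> f t = t `^ (p - 1) * f1 t].

(* C_{-1}^1(0, +oo) *)
Definition Cm1_1 (R : realType) (f : R -> R) : Prop :=
  (forall t : R, 0 < t -> derivable f t 1) /\ Cm1 (f^`())%classic.

(* The value at 0 of the continuous extension of f from (0, +oo). *)
Definition at0 (R : realType) (f : R -> R) : R := lim (f t @[t --> 0^'+]).

(* Laplace convolution, as a Lebesgue integral. Functions in C_{-1} may be
   unbounded at 0, so the integral is taken over the open interval. *)
Definition laplace_conv (R : realType) (f g : R -> R) (t : R) : R :=
  Rintegral (@lebesgue_measure R) `]0, t[ (fun tau => f tau * g (t - tau)).

(* Convolution power f * ... * f with j factors. It is only meaningful for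
   j >= 1: there is no unit, and [convpow f 0] is [f] by convention. *)
Definition convpow (R : realType) (f : R -> R) (j : nat) : R -> R :=
  iter j.-1 (fun g => laplace_conv g f) f.

(* Since laplace_conv is commutative on C_{-1}, this relation is symmetric there. *)
Definition associate (R : realType) (kappa k : R -> R) : Prop :=
  forall t : R, 0 < t -> laplace_conv kappa k t = 1.

(* S_{-1} *)
Definition sonine_kernel (R : realType) (k : R -> R) : Prop :=
  Cm10 k /\ exists kappa : R -> R, Cm10 kappa /\ associate kappa k.

(* General fractional derivative of Caputo type with kernel k. *)
Definition caputo_gfd (R : realType) (k y : R -> R) (t : R) : R :=
  ((laplace_conv k y)^`())%classic t - at0 y * k t.

Definition ivp_solution (R : realType) (k : R -> R) (lambda : R)
    (f : R -> R) (y0 : R) (y : R -> R) : Prop :=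
  [/\ Cm1_1 y,
      forall t : R, 0 < t ->
        derivable (laplace_conv k y) t 1 /\ caputo_gfd k y t - lambda * y t = f t &
      y t @[t --> 0^'+] --> y0].

(* Partial sums, over 1 <= j < n, of the series defining l_{kappa,lambda}. *)
Definition lseries_psum (R : realType) (kappa : R -> R) (lambda t : R)
    (n : nat) : R :=
  \sum_(1 <= j < n) lambda ^+ j.-1 * convpow kappa j t.

Definition lseries (R : realType) (kappa : R -> R) (lambda t : R) : R :=
  limn (lseries_psum kappa lambda t).

Definition Lseries (R : realType) (k kappa : R -> R) (lambda : R) : R -> R :=
  laplace_conv k (lseries kappa lambda).

(* Main.v *)
(* Write [*] for the Laplace convolution, under which C_{-1} is a commutative
   algebra, and [l = l_{kappa,lambda}], so that [l = kappa + lambda (l * kappa)].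
   Convergence of the series is geometric: multiplying [kappa] by [exp(-s t)]
   multiplies its convolution powers by the same factor, and for [s] large the
   damped kernel is as small as desired with respect to [t^(p/2-1)].

   Since [kappa * k = 1], the recursion gives [k * l = 1 + lambda (1 * l)]. With
   [f = c + 1 * f'] this makes [y = f * l + y0 (k * l)] a primitive of an element
   of C_{-1}, and yields [k * y = 1 * (f + y0 k + lambda y)], which is the
   integrated equation. For uniqueness, the difference [w = 1 * v] of two
   solutions satisfies [k * v = lambda w]; convolving with [kappa] gives
   [w = lambda (kappa * w)], and convolving this with [l] and using the recursion
   gives [kappa * w = 0], so [w = 0]. *)

Require Import Defs.
From HB Require Import structures.
From mathcomp Require Import all_boot all_order all_algebra.
From mathcomp Require Import all_classical all_reals all_analysis.
From mathcomp Require Import measurable_realfun ring lra.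

Set Implicit Arguments.
Unset Strict Implicit.
Unset Printing Implicit Defensive.

Import Order.TTheory GRing.Theory Num.Theory.
Import numFieldNormedType.Exports.

Local Open Scope classical_set_scope.
Local Open Scope ring_scope.

(** * Affine substitution in Lebesgue integrals *)

Section affine_substitution.
Context {R : realType}.
Notation mu := (@lebesgue_measure R).

Definition affine (a b : R) : measurableTypeR R -> measurableTypeR R :=
  fun x => a * x + b.

Lemma measurable_affine (a b : R) : measurable_fun setT (affine a b).
Proof. by apply: measurable_funD => //; exact: measurable_funM. Qed.

(** The right-hand side is a measure in [A] that gives the intervals []u, v]] their length, and
    these values determine Lebesgue measure. *)
Lemma lebesgue_measure_affine (a b : R) (A : set R) : a != 0 -> measurable A ->
  mu A = (`|a|%:E * mu (affine a b @^-1` A))%E.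
Proof.
move=> a0 mA.
pose nu' : {measure set (measurableTypeR R) -> \bar R} :=
  pushforward mu (affine a b).
pose nu : {measure set (measurableTypeR R) -> \bar R} :=
  mscale (NngNum (normr_ge0 a)) (nu' (measurable_affine a b)).
rewrite (@lebesgue_measure_unique _ nu) => // X [[u v]] /= uv <-.
rewrite /nu /= /mscale /= /pushforward.
have [a_gt0|a_lt0|aE] := ltgtP 0 a; last by rewrite -aE eqxx in a0.
- have -> : affine a b @^-1` `]u, v] = `](u - b) / a, (v - b) / a]%classic.
    apply/seteqP; split => x /=; rewrite !in_itv/= /affine;
      by rewrite ltr_pdivrMr// ler_pdivlMr// ltrBlDr lerBrDr (mulrC x).
  rewrite !lebesgue_measure_itv/= !lte_fin gtr0_norm// ltr_pM2r ?invr_gt0//.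
  rewrite ltrD2r; case: ifPn => _; last by rewrite mule0.
  by rewrite -!EFinD -EFinM; congr EFin; field.
(* A negative slope swaps the open and closed ends, which does not affect the length. *)
- have -> : affine a b @^-1` `]u, v] = `[(v - b) / a, (u - b) / a[%classic.
    apply/seteqP; split => x /=; rewrite !in_itv/= /affine;
      by rewrite ltr_ndivlMr// ler_ndivrMr// ltrBlDr lerBrDr (mulrC x) andbC.
  rewrite !lebesgue_measure_itv/= !lte_fin ltr0_norm// ltr_nM2r ?invr_lt0//.
  rewrite ltrD2r; case: ifPn => _; last by rewrite mule0.
  by rewrite -!EFinD -EFinM; congr EFin; field.
Qed.

Lemma ge0_integral_affine (a b : R) (F : R -> \bar R) : a != 0 ->
  measurable_fun setT F -> (forall x, 0 <= F x)%E ->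
  (\int[mu]_x F x = `|a|%:E * \int[mu]_x F (affine a b x))%E.
Proof.
move=> a0 mF F0.
pose nu : {measure set (measurableTypeR R) -> \bar R} :=
  pushforward mu (affine a b).
transitivity (\int[mscale (NngNum (normr_ge0 a))
    (nu (measurable_affine a b))]_x F x)%E.
  apply: eq_measure_integral => A mA _.
  exact: (lebesgue_measure_affine b a0 mA).
rewrite ge0_integral_mscale//= ge0_integral_pushforward//;
  exact: measurable_affine.
Qed.

Lemma integrable_affine (a b : R) (F : R -> R) : a != 0 ->
  mu.-integrable setT (EFin \o F) ->
  mu.-integrable setT (EFin \o (fun x => F (affine a b x))).
Proof.
move=> a0 /integrableP[mF iF]; apply/integrableP; split.
  exact: (measurableT_comp mF (measurable_affine a b)).
move: iF; rewrite (ge0_integral_affine b a0)//; last first.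
  exact: measurableT_comp.
case: (\int[mu]_x _)%E => [r _|/=|//]; first exact: ltry.
by rewrite gt0_muley ?lte_fin ?normr_gt0.
Qed.

(** The nonnegative case is applied to the positive and negative parts; integrability makes their
    difference well defined. *)
Lemma Rintegral_affine (a b : R) (F : R -> R) : a != 0 ->
  mu.-integrable setT (EFin \o F) ->
  Rintegral mu setT F = `|a| * Rintegral mu setT (fun x => F (affine a b x)).
Proof.
move=> a0 iF; have iFa := integrable_affine b a0 iF.
rewrite /Rintegral -[`|a|]/(fine `|a|%:E) -fineM//;
  last exact: integrable_fin_num.
congr fine; rewrite integralE [in RHS]integralE muleBr//; last first.
  rewrite fin_num_adde_defr//.
  by apply: integrable_pos_fin_num.
have mF := measurable_int _ iF.
rewrite (ge0_integral_affine b a0)//; last exact: measurable_funepos.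
rewrite [X in (_ - X)%E](ge0_integral_affine b a0)//;
  last exact: measurable_funeneg.
by congr (_ * _ - _ * _)%E; apply: eq_integral => x _;
  rewrite ?funeposE ?funenegE.
Qed.

End affine_substitution.

(** * Integrability of powers near the origin *)

Section powR_integrable.
Context {R : realType}.
Notation mu := (@lebesgue_measure R).
Implicit Types p q t : R.

Lemma continuous_powRl p (t : R) : 0 < t -> {for t, continuous (fun x => x `^
  p)}.
Proof.
move=> t0; apply: differentiable_continuous; apply/derivable1_diffP.
by apply: derivable_powR; rewrite in_itv/= t0.
Qed.

Lemma measurable_continuous_pos (f : R -> R) (D : set R) :
  (forall t, 0 < t -> {for t, continuous f}) -> measurable D ->
  D `<=` `]0, +oo[ -> measurable_fun D f.
Proof.
move=> cf mD DS; apply: (@measurable_funS _ _ _ _ (`]0, +oo[%classic : set R)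
  D) => //.
apply: open_continuous_measurable_fun; first exact: interval_open.
by move=> t; rewrite inE/= in_itv/= andbT; exact: cf.
Qed.


(** Discarding the value of the primitive [x^p / p] at [e] makes the bound independent of [e], which
    may then tend to 0. *)
Lemma integral_powR_le p e t : 0 < p -> 0 < e -> e < t ->
  (\int[mu]_(x in `[e, t]) (x `^ (p - 1))%:E <= (t `^ p / p)%:E)%E.
Proof.
move=> p0 e0 et.
rewrite (@continuous_FTC2 _ (fun x => x `^ (p - 1)) (fun x => x `^ p / p))//.
- by rewrite -EFinB lee_fin gerBl divr_ge0 ?powR_ge0 ?ltW.
- apply: continuous_in_subspaceT => x; rewrite inE/= in_itv/= => /andP[ex _].
  by apply: continuous_powRl; exact: lt_le_trans ex.
- have d x : 0 < x -> derivable (fun x => x `^ p / p) x 1.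
    by move=> x0; apply: derivableM => //; apply: derivable_powR;
      rewrite in_itv/= x0.
  have c x : 0 < x -> {for x, continuous (fun x => x `^ p / p)}.
    by move=> /d /derivable1_diffP /differentiable_continuous.
  split.
  + by move=> x; rewrite in_itv/= => /andP[ex _]; apply: d; exact: lt_trans ex.
  + by apply: cvg_at_right_filter; apply: c.
  + by apply: cvg_at_left_filter; apply: c; exact: lt_trans et.
- move=> x; rewrite in_itv/= => /andP[ex _].
  have x0 := lt_trans e0 ex.
  rewrite derive1E deriveM//; last by apply: derivable_powR;
    rewrite in_itv/= x0.
  have /@derive_val -> := is_derive1_powR p x0.
  rewrite derive_cst scaler0 add0r.
  by rewrite /GRing.scale/= mulrA mulVf ?mul1r ?gt_eqF.
Qed.

Lemma integrable_powR p t : 0 < p ->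
  mu.-integrable `]0, t[ (EFin \o (fun x => x `^ (p - 1))).
Proof.
move=> p0.
have mp (D : set R) : measurable D -> D `<=` `]0, +oo[ ->
    measurable_fun D (fun x : R => x `^ (p - 1)).
  by apply: measurable_continuous_pos => u; exact: continuous_powRl.
have sub0 : (`]0, t[ : set R) `<=` (`]0, +oo[ : set R).
  by move=> u /=; rewrite !in_itv/= => /andP[->].
apply/integrableP; split; first by apply/measurable_EFinP; exact: mp.
under eq_integral do rewrite /= ger0_norm ?powR_ge0//.
(* Truncation away from 0, for monotone convergence; the divisor [n.+2] keeps the left end strictly
   below [t] even at [n = 0]. *)
pose F (n : nat) := (EFin \o (fun x : R => x `^ (p - 1))) \_ `[t / n.+2%:R, t].
have [t0|t0] := leP t 0.
  by rewrite set_itv_ge ?integral_set0 ?ltry// bnd_simp -leNgt.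
have le1 n : t / n.+2%:R < t by rewrite ltr_pdivrMr// ltr_pMr// ltr1n.
have gt0n n : 0 < t / n.+2%:R by rewrite divr_gt0.
have F0 n x : (0 <= F n x)%E.
  by rewrite /F patchE; case: ifPn => // _; rewrite lee_fin powR_ge0.
have Fcvg x : `]0, t[%classic x -> F ^~ x @ \oo --> (x `^ (p - 1))%:E.
  rewrite /= in_itv/= => /andP[x0 xt].
  apply: cvg_near_cst; near=> n.
  rewrite /F patchE mem_set//= in_itv/= (ltW xt) andbT.
  rewrite ler_pdivrMr// mulrC -ler_pdivrMr//.
  rewrite (@le_trans _ _ n%:R)//; last by rewrite ler_nat leqW.
  by near: n; exact: nbhs_infty_ger.
apply: (@le_lt_trans _ _ (t `^ p / p)%:E); last exact: ltry.
have mF n : measurable_fun `]0, t[ (F n).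
  apply/measurable_restrict => //; apply/measurable_EFinP; apply: mp.
    exact: measurableI.
  by apply: subset_trans sub0; exact: subIsetl.
have ndF x : `]0, t[%classic x -> nondecreasing_seq (F ^~ x).
  move=> _ n m nm; rewrite /F !patchE; case: ifPn => [xn|_]; last first.
    by case: ifPn => // _; rewrite lee_fin powR_ge0.
  rewrite ifT// inE/=; move: xn; rewrite inE/= !in_itv/= => /andP[nx ->].
  by rewrite andbT (le_trans _ nx)// ler_pM2l// lef_pV2 ?posrE ?ltr0n// ler_nat
    !ltnS.
have := @cvg_monotone_convergence _ _ _ mu _ (measurable_itv `]0, t[) F mF
  (fun n x _ => F0 n x) ndF.
have -> : (\int[mu]_(x in `]0%R, t[) limn (F ^~ x) =
    \int[mu]_(x in `]0%R, t[) (x `^ (p - 1)%R)%:E)%E.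
  apply: eq_integral => x; rewrite inE => xt; apply/cvg_lim => //.
  exact: Fcvg.
move=> /cvg_lim <-//.
apply: lime_le.
  apply: ereal_nondecreasing_is_cvgn => n m nm.
  apply: ge0_le_integral => //.
  - exact: mF.
  - exact: mF.
  - by move=> x xt; exact: ndF.
near=> n.
apply: le_trans (integral_powR_le p0 (gt0n n) (le1 n)).
rewrite /F -integral_mkcondr; apply: ge0_subset_integral => //.
- exact: measurableI.
- apply/measurable_EFinP; apply: mp => // x /=; rewrite !in_itv/= andbT.
  by move=> /andP[+ _]; exact: lt_le_trans.
- by move=> x _; rewrite lee_fin powR_ge0.
Unshelve. all: by end_near. Qed.

End powR_integrable.

(** * The space C_{-1} *)

Section growth.
Context {R : realType}.
Implicit Types (f g : R -> R) (p q t : R).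

Lemma ler_powR_nexp (r a b : R) : r <= 1 -> 0 < a -> a <= b ->
  b `^ (r - 1) <= a `^ (r - 1).
Proof.
move=> r1 a0 ab; have b0 := lt_le_trans a0 ab.
rewrite -[r - 1]opprB !powRN lef_pV2 ?posrE ?powR_gt0//.
by rewrite ge0_ler_powR ?nnegrE ?subr_ge0 ?(ltW a0) ?(ltW b0).
Qed.

(** Order [t^(p-1)] at the origin. The constant may depend on [T], since nothing is required at
    infinity. *)
Definition growth p f := forall T, 0 < T ->
  exists C, forall t, 0 < t <= T -> `|f t| <= C * t `^ (p - 1).

Lemma growth_le p q f : p <= q -> growth q f -> growth p f.
Proof.
move=> pq gf T T0; have [C Cf] := gf T T0.
exists (`|C| * T `^ (q - p)) => t /andP[t0 tT].
have -> : `|C| * T `^ (q - p) * t `^ (p - 1) =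
    (`|C| * t `^ (p - 1)) * T `^ (q - p) by ring.
apply: (le_trans (Cf t _)); first by rewrite t0.
have -> : q - 1 = (p - 1) + (q - p) by ring.
rewrite powRD ?(gt_eqF t0) ?implybT// mulrA.
apply: (@le_trans _ _ (`|C| * t `^ (p - 1) * t `^ (q - p))).
  by rewrite !ler_wpM2r ?powR_ge0// ler_norm.
rewrite ler_wpM2l ?mulr_ge0 ?powR_ge0//.
by rewrite ge0_ler_powR ?nnegrE ?subr_ge0// ltW// (lt_le_trans t0).
Qed.

(* If [f] has order [t^(p-1)] at [0], then [t^(1-p/2) f t] tends to [0] there,
   so it extends continuously to [0, +oo). *)
Lemma Cm1P f : Cm1 f <->
  (forall t, 0 < t -> {for t, continuous f}) /\
  exists p, 0 < p <= 1 /\ growth p f.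
Proof.
split=> [[p [f1 [p0 cf1 fE]]]|[cf [p [/andP[p0 p1] gf]]]].
- have /continuous_within_itvcyP[cf1' _] := cf1.
  split.
    move=> t t0; have : {for t, continuous (fun t => t `^ (p - 1) * f1 t)}.
      apply: cvgM; first exact: continuous_powRl.
      by apply: cf1'; rewrite in_itv/= t0.
    rewrite /prop_for /continuous_at fE//; apply: cvg_trans.
    apply: near_eq_cvg; near=> x; rewrite fE//.
    by near: x; exact: lt_nbhsr.
  (* Capping the exponent at 1 makes [t^(p-1)] nonincreasing, on which later dominations rely. *)
  exists (Num.min p 1); split;
    first by rewrite lt_min p0 ltr01 ge_min lexx orbT.
  apply: (@growth_le _ p); first by rewrite ge_min lexx.
  move=> T T0.
  have cnf : {within `[0, T], continuous (fun x => `|f1 x|)}.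
    have := @continuous_subspaceW _ _ `[0, T]%classic `[0, +oo[%classic f1 _
      cf1.
    have /[swap]/[apply] : (`[0, T] : set R) `<=` `[0, +oo[.
      by move=> x /=; rewrite !in_itv/= => /andP[->].
    by move=> h x; apply: continuous_comp; [exact: h|exact: norm_continuous].
  have [c _ cP] := EVT_max (ltW T0) cnf.
  exists `|f1 c| => t /andP[t0 tT]; rewrite fE// normrM mulrC ler_pM//.
    by apply: cP; rewrite in_itv/= tT ltW.
  by rewrite ger0_norm ?powR_ge0.
- exists (p / 2), (fun t => if 0 < t then t `^ (1 - p / 2) * f t else 0).
  split; first by rewrite divr_gt0.
  + apply/continuous_within_itvcyP; split.
    * move=> t; rewrite in_itv/= andbT => t0.
      have : {for t, continuous (fun t => t `^ (1 - p / 2) * f t)}.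
        by apply: cvgM; [exact: continuous_powRl|exact: cf].
      rewrite /prop_for /continuous_at t0; apply: cvg_trans.
      apply: near_eq_cvg; near=> x; rewrite ifT//.
      by near: x; exact: lt_nbhsr.
    * rewrite ltxx; have [C Cf] := gf 1 ltr01.
      apply/cvgr0Pnorm_le => e e0; near=> x.
      have x0 : 0 < x by [].
      rewrite x0 normrM ger0_norm ?powR_ge0//.
      apply: (@le_trans _ _ (`|C| * x `^ (p / 2))).
        have -> : x `^ (p / 2) = x `^ (1 - p / 2) * x `^ (p - 1).
          by rewrite -powRD ?(gt_eqF x0) ?implybT//; congr (_ `^ _); field.
        rewrite mulrCA ler_wpM2l ?powR_ge0//.
        have x1 : x <= 1 by near: x; exact: nbhs_right_le.
        apply: (le_trans (Cf x _)); first by rewrite x0 x1.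
        by rewrite ler_wpM2r ?powR_ge0 ?ler_norm.
      have -> : `|C| * x `^ (p / 2) = `| `|C| * x `^ (p / 2) |.
        by rewrite [RHS]ger0_norm// mulr_ge0 ?powR_ge0.
      near: x; move: e e0; apply/cvgr0Pnorm_le.
      rewrite -[X in _ --> X](mulr0 `|C|); apply: cvgMr; apply: powR_cvg0.
      by rewrite divr_gt0.
  + move=> t t0; rewrite t0 mulrA -powRD ?(gt_eqF t0) ?implybT//.
    by rewrite (_ : _ + _ = 0) ?powRr0 ?mul1r//; ring.
Unshelve. all: by end_near. Qed.

Lemma Cm10_Cm1 f : Cm10 f -> Cm1 f.
Proof. by move=> [p [f1 [/andP[p0 _] cf1 fE]]]; exists p, f1. Qed.

Lemma Cm1_continuous f t : Cm1 f -> 0 < t -> {for t, continuous f}.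
Proof. by move=> /Cm1P[+ _]; exact. Qed.

Lemma Cm1_powR p : 0 < p -> Cm1 (fun t : R => t `^ (p - 1)).
Proof.
move=> p0; exists p, (fun=> 1); split => //; last by move=> t _; rewrite mulr1.
by apply: continuous_subspaceT => x; exact: cvg_cst.
Qed.

Lemma Cm1_cst c : Cm1 (fun=> c : R).
Proof.
exists 1, (fun=> c); split => //; last by move=> t _;
  rewrite subrr powRr0 mul1r.
by apply: continuous_subspaceT => x; exact: cvg_cst.
Qed.

Lemma Cm1D f g : Cm1 f -> Cm1 g -> Cm1 (fun t => f t + g t).
Proof.
move=> /Cm1P[cf [p [p01 gf]]] /Cm1P[cg [q [q01 gg]]]; apply/Cm1P; split.
  by move=> t t0; apply: cvgD; [exact: cf|exact: cg].
exists (Num.min p q); split.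
  by rewrite lt_min ge_min; move: p01 q01 => /andP[-> ->] /andP[-> _].
move=> T T0.
have [C Cf] : exists C, forall t, 0 < t <= T -> `|f t| <= C * t `^ (Num.min p q
  - 1).
  by apply: growth_le gf _ T0; rewrite ge_min lexx.
have [D Dg] : exists C, forall t, 0 < t <= T -> `|g t| <= C * t `^ (Num.min p q
  - 1).
  by apply: growth_le gg _ T0; rewrite ge_min lexx orbT.
exists (C + D) => t tT; rewrite (le_trans (ler_normD _ _))// mulrDl lerD//.
  exact: Cf.
exact: Dg.
Qed.

Lemma Cm1Z c f : Cm1 f -> Cm1 (fun t => c * f t).
Proof.
move=> [p [f1 [p0 cf fE]]]; exists p, (fun t => c * f1 t); split => //.
  by move=> x; apply: cvgMr; exact: cf.
by move=> t t0; rewrite fE// mulrCA.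
Qed.

Lemma Cm1_norm f : Cm1 f -> Cm1 (fun t => `|f t|).
Proof.
move=> /Cm1P[cf [p [p01 gf]]]; apply/Cm1P; split.
  by move=> t t0; apply: cvg_norm; exact: cf.
exists p; split => // T T0; have [C Cf] := gf _ T0.
by exists C => t tT; rewrite normr_id; exact: Cf.
Qed.

Lemma Cm1_eq f g : (forall t, 0 < t -> f t = g t) -> Cm1 f -> Cm1 g.
Proof.
by move=> fg [p [f1 [p0 cf fE]]]; exists p, f1; split => // t t0;
  rewrite -fg// fE.
Qed.

End growth.

(** * The convolution algebra on C_{-1} *)

Section interval_substitution.
Context {R : realType}.
Notation mu := (@lebesgue_measure R).
Implicit Types (f g : R -> R) (p q t : R).

Lemma integrable_restrict_itv (i : interval R) f :
  mu.-integrable [set` i] (EFin \o f) <->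
  mu.-integrable setT (EFin \o (f \_ [set` i])).
Proof. by rewrite -restrict_EFin; exact: integrable_mkcond. Qed.

Lemma integrable_EFinZ (D : set R) c f : measurable D ->
  mu.-integrable D (EFin \o f) -> mu.-integrable D (EFin \o (fun x => c * f x)).
Proof. by move=> mD; apply: (@integrableZl _ _ _ mu D _ c (EFin \o f)). Qed.

Lemma integrable_EFinD (D : set R) f g : measurable D ->
  mu.-integrable D (EFin \o f) -> mu.-integrable D (EFin \o g) ->
  mu.-integrable D (EFin \o (fun x => f x + g x)).
Proof. by move=> mD; apply: (@integrableD _ _ _ mu D _ (EFin \o f) (EFin \o
  g)). Qed.

(** Substitution with slope [-1], after extension by 0 to the whole line; the reflection maps []0,
    t[] onto itself. *)
Lemma integrable_flip t f : mu.-integrable `]0, t[ (EFin \o f) ->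
  mu.-integrable `]0, t[ (EFin \o (fun x => f (t - x))) /\
  Rintegral mu `]0, t[ (fun x => f (t - x)) = Rintegral mu `]0, t[ f.
Proof.
move=> /integrable_restrict_itv fi.
have N1 : (-1 : R) != 0 by rewrite oppr_eq0 oner_eq0.
have E : (fun x => (f \_ `]0, t[) (affine (-1) t x)) =
    (fun x => f (t - x)) \_ `]0, t[.
  apply/funext => x; rewrite !patchE /affine mulN1r addrC.
  congr (if _ then _ else _); apply/idP/idP;
    by rewrite !inE/= !in_itv/= subr_gt0 gtrBl andbC.
split.
  apply/integrable_restrict_itv; rewrite -E.
  exact: integrable_affine.
rewrite Rintegral_mkcond [RHS]Rintegral_mkcond [RHS](Rintegral_affine t N1 fi).
by rewrite normrN1 mul1r E.
Qed.

(** Passing to []0, 1[] turns the endpoint [t] into a parameter of the integrand, which serves for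
    continuity in [t] and for homogeneity. *)
Lemma integrable_scale t f : 0 < t -> mu.-integrable `]0, t[ (EFin \o f) ->
  mu.-integrable `]0, 1[ (EFin \o (fun x => f (t * x))) /\
  Rintegral mu `]0, t[ f = t * Rintegral mu `]0, 1[ (fun x => f (t * x)).
Proof.
move=> t0 /integrable_restrict_itv fi.
have tN0 : t != 0 by rewrite gt_eqF.
have E : (fun x => (f \_ `]0, t[) (affine t 0 x)) =
    (fun x => f (t * x)) \_ `]0, 1[.
  apply/funext => x; rewrite !patchE /affine addr0.
  congr (if _ then _ else _); apply/idP/idP;
    by rewrite !inE/= !in_itv/= pmulr_rgt0// gtr_pMr.
split.
  apply/integrable_restrict_itv; rewrite -E.
  exact: integrable_affine.
rewrite Rintegral_mkcond [in RHS]Rintegral_mkcond (Rintegral_affine 0 tN0 fi).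
by rewrite gtr0_norm// E.
Qed.

Lemma measurable_conv_integrand f g t :
  (forall x, 0 < x -> {for x, continuous f}) ->
  (forall x, 0 < x -> {for x, continuous g}) ->
  measurable_fun `]0, t[ (fun x => f x * g (t - x)).
Proof.
move=> cf cg; apply: open_continuous_measurable_fun; first exact: interval_open.
move=> x; rewrite inE/= in_itv/= => /andP[x0 xt].
apply: cvgM; first exact: cf.
apply: (@continuous_comp _ _ _ (fun x => t - x) g).
  by apply: cvgB; [exact: cvg_cst|exact: cvg_id].
by apply: cg; rewrite subr_gt0.
Qed.

(* The larger of [x] and [t - x] is at least [t / 2], so the singularities at
   the two ends of the interval are dominated separately. *)
Lemma integrable_beta p q t : 0 < p <= 1 -> 0 < q <= 1 -> 0 < t ->
  mu.-integrable `]0, t[ (EFin \o (fun x => x `^ (p - 1) * (t - x) `^ (q - 1))).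
Proof.
move=> /andP[p0 p1] /andP[q0 q1] t0.
pose G x := (t / 2) `^ (q - 1) * x `^ (p - 1) +
  (t / 2) `^ (p - 1) * (t - x) `^ (q - 1).
have iG : mu.-integrable `]0, t[ (EFin \o G).
  apply: integrable_EFinD => //; apply: integrable_EFinZ => //.
    exact: integrable_powR.
  exact: (integrable_flip (integrable_powR t q0)).1.
apply: le_integrable iG => //.
  apply/measurable_EFinP.
  by apply: (measurable_conv_integrand (f := fun x => x `^ (p - 1))
    (g := fun x => x `^ (q - 1))) => x; exact: continuous_powRl.
move=> x; rewrite /= in_itv/= => /andP[x0 xt].
have tx0 : 0 < t - x by rewrite subr_gt0.
have h0 : 0 < t / 2 by rewrite divr_gt0.
rewrite lee_fin !ger0_norm ?addr_ge0 ?mulr_ge0 ?powR_ge0//.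
have [xh|hx] := leP x (t / 2).
- rewrite ler_wpDr ?mulr_ge0 ?powR_ge0// mulrC ler_wpM2r ?powR_ge0//.
  by apply: ler_powR_nexp => //; rewrite lerBrDr; lra.
- rewrite ler_wpDl ?mulr_ge0 ?powR_ge0// ler_wpM2r ?powR_ge0//.
  by apply: ler_powR_nexp => //; exact: ltW.
Qed.

End interval_substitution.

Section convolution.
Context {R : realType}.
Notation mu := (@lebesgue_measure R).
Notation conv := (@laplace_conv R).
Implicit Types (f g h : R -> R) (p q t : R).

(** The growth bounds of the two factors dominate the integrand by a multiple of a beta
    integrand. *)
Lemma laplace_conv_integrable f g t : Cm1 f -> Cm1 g ->
  mu.-integrable `]0, t[ (EFin \o (fun x => f x * g (t - x))).
Proof.
move=> /Cm1P[cf [p [p01 gf]]] /Cm1P[cg [q [q01 gg]]].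
have [t0|t0] := leP t 0.
  by rewrite set_itv_ge ?bnd_simp -?leNgt//; exact: integrable_set0.
have [C Cf] := gf _ t0; have [D Dg] := gg _ t0.
apply: (@le_integrable _ _ _ mu _ (measurable_itv _) _
  (EFin \o (fun x => C * D * (x `^ (p - 1) * (t - x) `^ (q - 1))))).
- by apply/measurable_EFinP; exact: measurable_conv_integrand.
- move=> x; rewrite /= in_itv/= => /andP[x0 xt].
  rewrite lee_fin (le_trans _ (ler_norm _))// normrM.
  rewrite [leRHS](_ : _ = C * x `^ (p - 1) * (D * (t - x) `^ (q - 1)));
    last by ring.
  apply: ler_pM => //; [apply: Cf|apply: Dg]; first by rewrite x0 ltW.
  by rewrite subr_gt0 xt gerBl ltW.
- by apply: integrable_EFinZ => //; exact: integrable_beta.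
Qed.

(** This allows identities known for positive arguments alone to be rewritten inside a
    convolution. *)
Lemma eq_laplace_conv f f' g g' t : (forall x, 0 < x -> f x = f' x) ->
  (forall x, 0 < x -> g x = g' x) -> conv f g t = conv f' g' t.
Proof.
move=> ff gg; apply: eq_Rintegral => x; rewrite inE/= in_itv/= => /andP[x0 xt].
by rewrite ff// gg// subr_gt0.
Qed.

Lemma laplace_convC f g t : Cm1 f -> Cm1 g -> conv f g t = conv g f t.
Proof.
move=> cf cg; rewrite /laplace_conv -(integrable_flip (laplace_conv_integrable
  t cf cg)).2.
by apply: eq_Rintegral => x _; rewrite subKr mulrC.
Qed.

Lemma laplace_convDl f g h t : Cm1 f -> Cm1 g -> Cm1 h ->
  conv (fun x => f x + g x) h t = conv f h t + conv g h t.
Proof.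
move=> cf cg ch; rewrite /laplace_conv.
rewrite -(RintegralD _ (laplace_conv_integrable t cf ch)
  (laplace_conv_integrable t cg ch))//.
by apply: eq_Rintegral => x _; rewrite mulrDl.
Qed.

Lemma laplace_convZl c f g t : Cm1 f -> Cm1 g ->
  conv (fun x => c * f x) g t = c * conv f g t.
Proof.
move=> cf cg; rewrite /laplace_conv -(RintegralZl _ _ (laplace_conv_integrable
  t cf cg))//.
by apply: eq_Rintegral => x _; rewrite mulrA.
Qed.

Lemma laplace_convDr f g h t : Cm1 f -> Cm1 g -> Cm1 h ->
  conv f (fun x => g x + h x) t = conv f g t + conv f h t.
Proof.
by move=> cf cg ch; rewrite laplace_convC ?laplace_convDl ?(laplace_convC t
  cf)//; exact: Cm1D.
Qed.

Lemma laplace_convZr c f g t : Cm1 f -> Cm1 g ->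
  conv f (fun x => c * g x) t = c * conv f g t.
Proof. by move=> cf cg; rewrite laplace_convC ?laplace_convZl ?(laplace_convC t
  cf)//; exact: Cm1Z. Qed.

Lemma ler_norm_laplace_conv f g f' g' t : Cm1 f -> Cm1 g -> Cm1 f' -> Cm1 g' ->
  (forall x, 0 < x < t -> `|f x| <= f' x) ->
  (forall x, 0 < x < t -> `|g x| <= g' x) -> `|conv f g t| <= conv f' g' t.
Proof.
move=> cf cg cf' cg' ff gg.
rewrite (le_trans (le_normr_Rintegral _ (laplace_conv_integrable t cf cg)))//.
apply: le_Rintegral => //; first exact: (integrable_norm
  (laplace_conv_integrable t cf cg)).
  exact: laplace_conv_integrable.
move=> x; rewrite /= in_itv/= => /andP[x0 xt]; rewrite normrM.
apply: ler_pM => //; first by apply: ff; rewrite x0.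
by apply: gg; rewrite subr_gt0 xt gtrBl.
Qed.

(** Homogeneity, by rescaling to []0, 1[]. The constant is the beta value [B(p, q)], which never has
    to be computed. *)
Lemma laplace_conv_powR p q t : 0 < p -> 0 < q -> 0 < t ->
  conv (fun x => x `^ (p - 1)) (fun x => x `^ (q - 1)) t =
  conv (fun x => x `^ (p - 1)) (fun x => x `^ (q - 1)) 1 * t `^ (p + q - 1).
Proof.
move=> p0 q0 t0; have := laplace_conv_integrable t (Cm1_powR p0) (Cm1_powR q0).
move=> /(integrable_scale t0)[_]; rewrite /laplace_conv => ->.
have i1 := laplace_conv_integrable 1 (Cm1_powR p0) (Cm1_powR q0).
have -> : t `^ (p + q - 1) = t * (t `^ (p - 1) * t `^ (q - 1)).
  rewrite -{2}(powRr1 (ltW t0)) -!powRD ?(gt_eqF t0) ?implybT//.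
  by congr (_ `^ _); ring.
rewrite mulrCA; congr (_ * _).
rewrite mulrC -RintegralZl//; apply: eq_Rintegral => x.
rewrite inE/= in_itv/= => /andP[x0 x1].
rewrite -{2}[t]mulr1 -mulrBr !powRM ?ltW ?subr_gt0//; ring.
Qed.

(** The factors are compared with powers, whose convolution is again a power. *)
Lemma growth_conv p q f g : 0 < p <= 1 -> 0 < q <= 1 -> Cm1 f -> Cm1 g ->
  growth p f -> growth q g -> growth (p + q) (conv f g).
Proof.
move=> p01 q01 cf cg gf gg T T0.
have /andP[p0 _] := p01; have /andP[q0 _] := q01.
have [C Cf] := gf _ T0; have [D Dg] := gg _ T0.
have cp := Cm1_powR (R := R) p0; have cq := Cm1_powR (R := R) q0.
exists (C * D * conv (fun x => x `^ (p - 1)) (fun x => x `^ (q - 1)) 1).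
move=> t /andP[t0 tT].
rewrite (le_trans (ler_norm_laplace_conv (f' := fun x => C * x `^ (p - 1))
  (g' := fun x => D * x `^ (q - 1)) cf cg (Cm1Z C cp) (Cm1Z D cq) _ _))//.
- by move=> x /andP[x0 xt]; apply: Cf; rewrite x0 (le_trans (ltW xt)).
- by move=> x /andP[x0 xt]; apply: Dg; rewrite x0 (le_trans (ltW xt)).
rewrite laplace_convZl//; last exact: Cm1Z.
by rewrite laplace_convZr// laplace_conv_powR// !mulrA.
Qed.

End convolution.

(** * Continuity, associativity and differentiation of convolutions *)

Section convolution_analysis.
Context {R : realType}.
Notation mu := (@lebesgue_measure R).
Notation conv := (@laplace_conv R).
Implicit Types (f g h : R -> R) (p q t : R).

Lemma laplace_conv_scale f g t : Cm1 f -> Cm1 g -> 0 < t ->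
  mu.-integrable `]0, 1[ (EFin \o (fun s => f (t * s) * g (t - t * s))) /\
  conv f g t = t * Rintegral mu `]0, 1[ (fun s => f (t * s) * g (t - t * s)).
Proof. by move=> cf cg t0; exact: (integrable_scale t0 (laplace_conv_integrable
  t cf cg)). Qed.

(** After rescaling to []0, 1[] the integral depends on [t] only through its integrand, and a
    domination uniform near [t] gives continuity. *)
Lemma continuous_laplace_conv f g t : Cm1 f -> Cm1 g -> 0 < t ->
  {for t, continuous (conv f g)}.
Proof.
move=> cf cg t0.
suff : {for t, continuous
    (fun x : R => x * Rintegral mu `]0, 1[ (fun s => f (x * s) * g (x - x *
      s)))}.
  rewrite /prop_for /continuous_at -(laplace_conv_scale cf cg t0).2;
    apply: cvg_trans.
  apply: near_eq_cvg; near=> x; rewrite (laplace_conv_scale cf cg _).2//.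
  by near: x; exact: lt_nbhsr.
apply: cvgM; first exact: cvg_id.
have h0 : 0 < t / 2 by rewrite divr_gt0.
have [_ [p [p01 gf]]] := (Cm1P f).1 cf.
have [_ [q [q01 gg]]] := (Cm1P g).1 cg.
have t20 : 0 < 2 * t by rewrite mulr_gt0.
have [C Cf] := gf _ t20; have [D Dg] := gg _ t20.
have /andP[p0 p1] := p01; have /andP[q0 q1] := q01.
have C0 : 0 <= C.
  have := le_trans (normr_ge0 _) (Cf (2 * t) _).
  by rewrite t20 lexx => /(_ isT); rewrite pmulr_lge0 ?powR_gt0.
have D0 : 0 <= D.
  have := le_trans (normr_ge0 _) (Dg (2 * t) _).
  by rewrite t20 lexx => /(_ isT); rewrite pmulr_lge0 ?powR_gt0.
(* For [x > t / 2] and [p <= 1], [(x s)^(p-1) <= (t/2)^(p-1) s^(p-1)], and likewise for the other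
   factor; the bound is free of [x]. *)
pose K := C * (t / 2) `^ (p - 1) * (D * (t / 2) `^ (q - 1)).
apply: (@continuity_under_integral R _ _ mu
  (fun x s => f (x * s) * g (x - x * s)) `]0, 1[ _ (t / 2) (2 * t) _ _
  (fun s => K * (s `^ (p - 1) * (1 - s) `^ (q - 1)))) => //.
- move=> x; rewrite /= in_itv/= => /andP[hx _].
  by apply: (laplace_conv_scale cf cg _).1; exact: lt_trans hx.
- apply: aeW => y; rewrite /= in_itv/= => /andP[y0 y1] x.
  rewrite inE/= in_itv/= => /andP[hx _]; have x0 := lt_trans h0 hx.
  apply: cvgM.
    apply: (@continuous_comp R R R (fun x : R => x * y) f x).
      by apply: cvgMl; exact: cvg_id.
    by apply: Cm1_continuous; rewrite ?mulr_gt0.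
  apply: (@continuous_comp R R R (fun x : R => x - x * y) g x).
    by apply: cvgB; [exact: cvg_id|apply: cvgMl; exact: cvg_id].
  by apply: Cm1_continuous; rewrite // subr_gt0 gtr_pMr.
- by apply: integrable_EFinZ => //; exact: integrable_beta.
- move=> x; rewrite /= in_itv/= => /andP[hx xt2]; have x0 := lt_trans h0 hx.
  apply: aeW => y; rewrite /= in_itv/= => /andP[y0 y1]; rewrite normrM.
  rewrite /K [leRHS](_ : _ = (C * ((t / 2) `^ (p - 1) * y `^ (p - 1))) *
     (D * ((t / 2) `^ (q - 1) * (1 - y) `^ (q - 1)))); last by ring.
  have y10 : 0 < 1 - y by rewrite subr_gt0.
  have -> : x - x * y = x * (1 - y) by ring.
  apply: ler_pM => //.
  + rewrite (le_trans (Cf _ _))//.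
      by rewrite mulr_gt0//= (le_trans _ (ltW xt2))// ger_pMr// ltW.
    by rewrite ler_wpM2l// powRM ?(ltW x0) ?(ltW y0)// ler_wpM2r ?powR_ge0//
      ler_powR_nexp// ltW.
  + rewrite (le_trans (Dg _ _))//.
      by rewrite mulr_gt0//= (le_trans _ (ltW xt2))// ger_pMr// gerBl ltW.
    by rewrite ler_wpM2l// powRM ?(ltW x0) ?(ltW y10)// ler_wpM2r ?powR_ge0//
      ler_powR_nexp// ltW.
- by rewrite inE/= in_itv/=; lra.
Unshelve. all: by end_near. Qed.

Lemma Cm1_conv f g : Cm1 f -> Cm1 g -> Cm1 (conv f g).
Proof.
move=> cf cg; have [_ [p [p01 gf]]] := (Cm1P f).1 cf.
have [_ [q [q01 gg]]] := (Cm1P g).1 cg.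
apply/Cm1P; split; first by move=> t; exact: continuous_laplace_conv.
exists p; split => //; apply: growth_le (growth_conv p01 q01 cf cg gf gg).
by rewrite lerDl; case/andP: q01 => /ltW.
Qed.

(* With functions extended by [0] to the whole line, convolutions become
   integrals over the line, to which Fubini's theorem and translations apply. *)
Let ext f := f \_ `]0, +oo[.

Let ext_conv_integrand f g t :
  (fun x => ext f x * ext g (t - x)) = (fun x => f x * g (t - x)) \_ `]0, t[.
Proof.
apply/funext => x; rewrite /ext !patchE !mem_setE !in_itv/= !andbT subr_gt0.
by case: (ltP 0 x); case: (ltP x t); rewrite //= ?mul0r ?mulr0.
Qed.

Let ext_conv_integrable f g t : Cm1 f -> Cm1 g ->
  mu.-integrable setT (EFin \o (fun x => ext f x * ext g (t - x))).
Proof.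
move=> cf cg; rewrite ext_conv_integrand; apply/integrable_restrict_itv.
exact: laplace_conv_integrable.
Qed.

Let ext_convE f g t :
  Rintegral mu setT (fun x => ext f x * ext g (t - x)) = conv f g t.
Proof. by rewrite ext_conv_integrand -Rintegral_mkcond. Qed.

Let ext_conv f g : ext (conv f g) = conv f g.
Proof.
apply/funext => x; rewrite /ext patchE; case: ifPn => //.
rewrite notin_setE/= in_itv/= andbT => /negP; rewrite -leNgt => x0.
by rewrite /laplace_conv set_itv_ge ?Rintegral_set0// bnd_simp -leNgt.
Qed.

Let measurable_ext f : Cm1 f -> measurable_fun setT (ext f).
Proof.
move=> cf; apply/(measurable_restrictT _ _).1 => //.
by apply: measurable_continuous_pos => // t; exact: Cm1_continuous.
Qed.

(** The factor [c] stands for the third function of a double convolution, constant in the inner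
    integral. *)
Let integral_ext_conv f g c s : Cm1 f -> Cm1 g ->
  (\int[mu]_x (ext f x * ext g (s - x) * c)%:E = (ext (conv f g) s * c)%:E)%E.
Proof.
move=> cf cg; have fgi := ext_conv_integrable s cf cg.
under eq_integral do rewrite EFinM.
rewrite (integralZr _ fgi)// EFinM ext_conv -ext_convE /Rintegral fineK//.
exact: integrable_fin_num fgi.
Qed.

Let integral_shift_ext_conv f g x t : Cm1 f -> Cm1 g ->
  mu.-integrable setT (EFin \o (fun s => ext f (s - x) * ext g (t - s))) /\
  (\int[mu]_s (ext f (s - x) * ext g (t - s))%:E = (conv f g (t - x))%:E)%E.
Proof.
move=> cf cg; have fgi := ext_conv_integrable (t - x) cf cg.
have N1 : (1 : R) != 0 by rewrite oner_eq0.
have := Rintegral_affine (- x) N1 fgi.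
have := integrable_affine (- x) N1 fgi.
rewrite ext_convE normr1 mul1r.
rewrite (_ : (fun s => _ * _) = (fun s => ext f (s - x) * ext g (t - s))).
  move=> fgi' ->; split => //.
  by rewrite /Rintegral fineK//; exact: integrable_fin_num fgi'.
by apply/funext => s; rewrite /affine mul1r; congr (_ * ext g _); ring.
Qed.

(** Fubini's theorem for [f(x) g(s - x) h(t - s)]: integrating in [x] first gives the left side, in
    [s] first the right side. *)
Lemma laplace_convA f g h t : Cm1 f -> Cm1 g -> Cm1 h ->
  conv (conv f g) h t = conv f (conv g h) t.
Proof.
move=> cf cg ch.
have mf := measurable_ext cf; have mg := measurable_ext cg.
have mh := measurable_ext ch.
have cfg := Cm1_conv cf cg; have cgh := Cm1_conv cg ch.
pose F (z : measurableTypeR R * measurableTypeR R) : \bar R :=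
  (ext f z.2 * ext g (z.1 - z.2) * ext h (t - z.1))%:E.
have mF : measurable_fun setT F.
  apply/measurable_EFinP; apply: measurable_funM; [apply: measurable_funM|].
  - by apply: (measurableT_comp mf); exact: measurable_snd.
  - apply: (measurableT_comp mg); apply: measurable_funB;
      [exact: measurable_fst|exact: measurable_snd].
  - apply: (measurableT_comp mh); apply: measurable_funB;
      [exact: measurable_cst|exact: measurable_fst].
have normE f' x : `|ext f' x| = ext (fun x => `|f' x|) x.
  by rewrite /ext !patchE; case: ifP; rewrite ?normr0.
(* The iterated integral of the absolute values is the double convolution of [|f|], [|g|] and [|h|]
   at [t], hence finite. *)
have iF : (mu \x mu)%E.-integrable setT F.
  apply/(@integrable12ltyP _ _ _ _ R mu mu F mF).
  under eq_integral => s _.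
    under eq_integral => x _.
      rewrite /F/= !normrM !normE.
      over.
    rewrite integral_ext_conv; [|exact: Cm1_norm|exact: Cm1_norm].
    over.
  have := integrable_lty measurableT (ext_conv_integrable t
    (Cm1_conv (Cm1_norm cf) (Cm1_norm cg)) (Cm1_norm ch)).
  by [].
have := Fubini iF.
under eq_integral => s _ do rewrite /F/= integral_ext_conv//.
have -> : (\int[mu]_s (ext (conv f g) s * ext h (t - s))%:E =
    (conv (conv f g) h t)%:E)%E.
  under eq_integral => s _ do rewrite -[X in X%:E]mulr1.
  by rewrite integral_ext_conv// ext_conv mulr1.
under eq_integral => x _.
  rewrite (_ : (\int[mu]_s F (s, x) =
      (ext f x * ext (conv g h) (t - x))%:E)%E); last first.
    under eq_integral => s _ do rewrite /F/= -mulrA EFinM.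
    have [ghi ghE] := integral_shift_ext_conv x t cg ch.
    by rewrite (integralZl _ ghi)// ghE ext_conv.
  over.
under [RHS]eq_integral => s _ do rewrite -[X in X%:E]mulr1.
by rewrite integral_ext_conv// ext_conv mulr1 => -[].
Qed.

Lemma laplace_convCA f g h t : Cm1 f -> Cm1 g -> Cm1 h ->
  conv f (conv g h) t = conv g (conv f h) t.
Proof.
move=> cf cg ch.
rewrite -(laplace_convA t cf cg ch) -(laplace_convA t cg cf ch).
by apply: eq_laplace_conv => // x _; exact: laplace_convC.
Qed.

Lemma laplace_conv1E g t : Cm1 g -> 0 < t ->
  conv (fun=> 1) g t = Rintegral mu `]0, t] g.
Proof.
move=> cg t0; rewrite laplace_convC//; last exact: Cm1_cst.
have := laplace_conv_integrable t cg (Cm1_cst 1).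
rewrite (_ : (fun x => g x * 1) = g); last by apply/funext => x; rewrite mulr1.
move=> gi; rewrite -Rintegral_itv_bndo_bndc//.
by apply: eq_Rintegral => x _; rewrite mulr1.
Qed.

Lemma derivable_is_derive1 (F : R -> R) t : derivable F t 1 ->
  is_derive t 1 F ((F^`())%classic t).
Proof. by move=> dF; rewrite derive1E; exact: derivableP. Qed.

Lemma near_derive1_is_derive (F G : R -> R) t d : {near t, F =1 G} ->
  derivable F t 1 -> (F^`())%classic t = d -> is_derive t 1 G d.
Proof.
move=> FG dF <-; apply: (near_eq_is_derive FG).
exact: derivable_is_derive1.
Qed.

Lemma is_derive_conv1 g t : Cm1 g -> 0 < t ->
  is_derive t 1 (conv (fun=> 1) g) (g t).
Proof.
move=> cg t0; have t1 : t < t + 1 by rewrite ltrDl.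
have gi : mu.-integrable `]0, t + 1] (EFin \o g).
  (* Convolution with 1 gives integrability on []0, t + 2[], which contains []0, t + 1]]. *)
  have := laplace_conv_integrable (t + 2) cg (Cm1_cst 1).
  rewrite (_ : (fun x => g x * 1) = g); last by apply/funext => x;
    rewrite mulr1.
  apply: integrableS => // x /=; rewrite !in_itv/= => /andP[-> /=]; lra.
have [|dF FE] := continuous_FTC1 t1 gi _ (Cm1_continuous cg t0).
  by rewrite lte_fin.
apply: near_derive1_is_derive dF FE.
by near=> y; rewrite laplace_conv1E//; near: y; exact: lt_nbhsr.
Unshelve. all: by end_near. Qed.

(** The constant 1 has order 1, so orders add up to [1 + p] and the convolution is [O(t^p)]. *)
Lemma cvg_conv1 g : Cm1 g -> conv (fun=> 1) g t @[t --> 0^'+] --> 0.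
Proof.
move=> cg; have [_ [p [p01 gg]]] := (Cm1P g).1 cg.
have g1 : growth 1 (fun=> 1 : R).
  by move=> T T0; exists 1 => t _; rewrite subrr powRr0 normr1 mulr1.
have [|C Cc] := growth_conv _ p01 (Cm1_cst 1) cg g1 gg (ltr01 : 0 < 1 :> R).
  by rewrite ltr01 lexx.
apply/cvgr0Pnorm_le => e e0; near=> t.
have t0 : 0 < t by [].
have t1 : t <= 1 by near: t; exact: nbhs_right_le.
apply: (@le_trans _ _ (`|C| * t `^ p)).
  rewrite (le_trans (Cc t _)) ?t0// addrAC subrr add0r.
  by rewrite ler_wpM2r ?powR_ge0 ?ler_norm.
have -> : `|C| * t `^ p = `| `|C| * t `^ p |.
  by rewrite [RHS]ger0_norm// mulr_ge0 ?powR_ge0.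
near: t; move: e e0; apply/cvgr0Pnorm_le.
rewrite -[X in _ --> X](mulr0 `|C|); apply: cvgMr; apply: powR_cvg0.
by case/andP: p01.
Unshelve. all: by end_near. Qed.

(** The difference of [f] and the convolution has zero derivative on []0, +oo[], hence is constant
    by the mean value theorem. By [cvg_conv1], [c] is the limit of [f] at 0. *)
Lemma Cm1_1_primitive f : Cm1_1 f ->
  exists c, forall t, 0 < t -> f t = c + conv (fun=> 1) (f^`())%classic t.
Proof.
move=> [df cf']; pose d t := f t - conv (fun=> 1) (f^`())%classic t.
have dd t : 0 < t -> is_derive t 1 d 0.
  move=> t0; have df1 := derivable_is_derive1 (df t t0).
  have := is_deriveB df1 (is_derive_conv1 cf' t0).
  by rewrite subrr.
have dE a b : 0 < a -> a <= b -> d b = d a.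
  move=> a0 ab; apply: subr0_eq.
  have [||c _ ->] := @MVT_segment _ d (fun=> 0) a b ab; last by rewrite mul0r.
    by move=> x; rewrite in_itv/= => /andP[ax _]; apply: dd; exact: lt_trans ax.
  apply: derivable_within_continuous => x; rewrite in_itv/= => /andP[ax _].
  by have [] := dd x (lt_le_trans a0 ax).
exists (d 1) => t t0.
have <- : d t = d 1.
  by have [t1|/ltW t1] := leP t 1; [rewrite (dE t 1)|rewrite (dE 1 t)].
by rewrite /d subrK.
Qed.

End convolution_analysis.

(** * Convolution series *)

Section series.
Context {R : realType}.
Notation mu := (@lebesgue_measure R).
Notation conv := (@laplace_conv R).
Implicit Types (f g h : R -> R) (p q t : R).

(** For [x >= 1], [x^a <= x <= 1 + x <= expR x]; below 1 the two sides are separated by 1. *)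
Lemma powR_le_expR (a x : R) : 0 < a <= 1 -> 0 <= x -> x `^ a <= expR x.
Proof.
move=> /andP[a0 a1] x0; have [x1|x1] := leP 1 x.
  rewrite (le_trans (ler1_powR x1 a1))// (le_trans _ (expR_ge1Dx x))//.
  by rewrite lerDr.
rewrite (@le_trans _ _ 1)//; last by rewrite -expR0 ler_expR.
have <- : 1 `^ a = 1 :> R by rewrite powR1.
by rewrite ge0_ler_powR ?nnegrE ?(ltW a0)// ltW.
Qed.

(* Half of the exponent is traded for a factor as small as desired. *)
Lemma growth_damped p f (T d : R) : 0 < p <= 1 -> growth p f -> 0 < T -> 0 < d
  ->
  exists2 s, 0 <= s &
  forall t, 0 < t <= T -> `|f t| <= expR (s * t) * (d * t `^ (p / 2 - 1)).
Proof.
move=> /andP[p0 p1] gf T0 d0; have [C Cf] := gf _ T0.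
have p20 : 0 < p / 2 by rewrite divr_gt0.
(* This [s] solves [d s^(p/2) = |C|], so that [|C| t^(p-1)] is exactly [(s t)^(p/2) d t^(p/2-1)]. *)
exists ((`|C| / d) `^ (p / 2)^-1); first exact: powR_ge0.
move=> t tT; have /andP[t0 _] := tT; set s := (_ `^ _).
rewrite (le_trans (Cf _ tT))// (@le_trans _ _ (`|C| * t `^ (p - 1)))//.
  by rewrite ler_wpM2r ?powR_ge0 ?ler_norm.
have -> : `|C| * t `^ (p - 1) = (s * t) `^ (p / 2) * (d * t `^ (p / 2 - 1)).
  rewrite powRM ?powR_ge0 ?(ltW t0)// /s -powRrM mulVf ?gt_eqF//.
  rewrite powRr1 ?divr_ge0 ?(ltW d0)//.
  have -> : t `^ (p - 1) = t `^ (p / 2) * t `^ (p / 2 - 1).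
    by rewrite -powRD ?(gt_eqF t0) ?implybT//; congr (_ `^ _); field.
  by field; rewrite gt_eqF.
rewrite ler_wpM2r ?mulr_ge0 ?powR_ge0 ?(ltW d0)//.
apply: powR_le_expR; last by rewrite mulr_ge0 ?powR_ge0 ?(ltW t0).
by rewrite p20 ler_pdivrMr// mul1r (le_trans p1)// ler1n.
Qed.

Lemma Cm1_expR s f : Cm1 f -> Cm1 (fun t => expR (s * t) * f t).
Proof.
move=> [p [f1 [p0 cf fE]]]; exists p, (fun t => expR (s * t) * f1 t);
  split => //.
  have ce : {within `[0, +oo[, continuous (fun t => expR (s * t))}.
    apply: continuous_subspaceT => y.
    apply: (@continuous_comp R R R (fun y : R => s * y) expR y).
      by apply: cvgMr; exact: cvg_id.
    exact: continuous_expR.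
  by move=> x; apply: cvgM; [exact: ce|exact: cf].
by move=> t t0; rewrite fE// mulrCA.
Qed.

(* Convolution commutes with multiplication by an exponential, so bounds can be
   propagated through convolution powers with the weight [expR (s * t)]. *)
Lemma laplace_conv_expR s f g t : Cm1 f -> Cm1 g ->
  conv (fun x => expR (s * x) * f x) (fun x => expR (s * x) * g x) t =
  expR (s * t) * conv f g t.
Proof.
move=> cf cg; rewrite /laplace_conv -RintegralZl//.
  apply: eq_Rintegral => x _; rewrite mulrACA -expRD.
  by congr (expR _ * _); ring.
exact: laplace_conv_integrable.
Qed.

(** The weight factors out of the convolution and the powers contribute a beta constant; compared
    with the bound on [f], a factor [t^q] is gained. *)
Lemma laplace_conv_damped q s f g (A D T : R) : 0 < q -> Cm1 f -> Cm1 g ->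
  (forall t, 0 < t <= T -> `|f t| <= expR (s * t) * (A * t `^ (q - 1))) ->
  (forall t, 0 < t <= T -> `|g t| <= expR (s * t) * (D * t `^ (q - 1))) ->
  forall t, 0 < t <= T -> `|conv f g t| <= expR (s * t) *
    (A * D * conv (fun x => x `^ (q - 1)) (fun x => x `^ (q - 1)) 1 *
     t `^ (q + q - 1)).
Proof.
move=> q0 cf cg Af Dg t /andP[t0 tT].
have cq := Cm1_powR (R := R) q0.
rewrite (le_trans (ler_norm_laplace_conv cf cg
  (Cm1_expR s (Cm1Z A cq)) (Cm1_expR s (Cm1Z D cq)) _ _))//.
- by move=> x /andP[x0 xt]; apply: Af; rewrite x0 (le_trans (ltW xt)).
- by move=> x /andP[x0 xt]; apply: Dg; rewrite x0 (le_trans (ltW xt)).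
rewrite laplace_conv_expR ?laplace_convZl ?laplace_convZr//; try exact: Cm1Z.
by rewrite laplace_conv_powR// !mulrA.
Qed.

Lemma convpowS f j : convpow f j.+2 = conv (convpow f j.+1) f.
Proof. by []. Qed.

Lemma Cm1_convpow f j : Cm1 f -> Cm1 (convpow f j.+1).
Proof.
by move=> cf; elim: j => // j IH; rewrite convpowS; exact: Cm1_conv.
Qed.

(** By damping, each further convolution with [kappa] costs an arbitrarily small factor on []0, T]].
    The exponent [q] is independent of [T], while [A] is not. *)
Lemma convpow_geometric kappa lambda : Cm1 kappa -> exists2 q, 0 < q <= 1 &
  forall T, 0 < T -> exists2 A, 0 <= A & forall j t, 0 < t <= T ->
    `|lambda ^+ j * convpow kappa j.+1 t| <= A * 2^-1 ^+ j * t `^ (q - 1).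
Proof.
move=> ck; have [_ [p [p01 gp]]] := (Cm1P kappa).1 ck.
have /andP[p0 p1] := p01.
pose q := p / 2; have q0 : 0 < q by rewrite divr_gt0.
exists q => [|T T0]; first by rewrite q0 ler_pdivrMr// mul1r (le_trans p1)//
  ler1n.
pose B := conv (fun x => x `^ (q - 1)) (fun x => x `^ (q - 1)) 1.
have B0 : 0 <= B.
  by apply: Rintegral_ge0 => x _; rewrite mulr_ge0 ?powR_ge0.
have [K K0 KE] : exists2 K, 0 <= K & K = B * T `^ q.
  by exists (B * T `^ q) => //; rewrite mulr_ge0 ?powR_ge0.
(* One convolution multiplies the damped bound by at most [d * K], since [t^q <= T^q]; [d] is chosen
   to make the ratio of the series at most one half. *)
have [d d0 dK] : exists2 d, 0 < d & `|lambda| * (d * K) <= 2^-1.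
  have l0 : 0 < `|lambda| + 1 by rewrite ltr_wpDl.
  have K1 : 0 < K + 1 by rewrite ltr_wpDl.
  exists (2 * (`|lambda| + 1) * (K + 1))^-1;
    first by rewrite invr_gt0 !mulr_gt0.
  rewrite mulrCA mulrC ler_pdivrMr ?mulr_gt0//.
  rewrite [leRHS](_ : _ = (`|lambda| + 1) * (K + 1)); last by field.
  by rewrite ler_pM// lerDl.
have dK0 : 0 <= d * K by rewrite mulr_ge0 ?(ltW d0).
have dKj0 j : 0 <= d * (d * K) ^+ j by rewrite mulr_ge0 ?exprn_ge0 ?(ltW d0).
have [s s0 ks] := growth_damped p01 gp T0 d0.
have bnd j t : 0 < t <= T -> `|convpow kappa j.+1 t| <=
    expR (s * t) * (d * (d * K) ^+ j * t `^ (q - 1)).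
  elim: j t => [|j IH] t tT; first by rewrite expr0 mulr1; exact: ks.
  rewrite convpowS.
  rewrite (le_trans (laplace_conv_damped q0 (Cm1_convpow j ck) ck IH ks tT))//.
  have /andP[t0 tT'] := tT.
  rewrite ler_wpM2l ?expR_ge0// -/B -addrA powRD ?(gt_eqF t0) ?implybT//.
  rewrite [leRHS](_ : _ = d * (d * K) ^+ j * d * B * (T `^ q * t `^ (q - 1))).
    apply: ler_wpM2l.
      by rewrite mulr_ge0// mulr_ge0 ?(ltW d0).
    rewrite ler_wpM2r ?powR_ge0// ge0_ler_powR ?nnegrE ?(ltW q0) ?(ltW t0)//.
    exact: ltW.
  by rewrite exprS KE; ring.
(* The weight [expR (s * t)] is at most [expR (s * T)] and is absorbed into [A]. *)
exists (expR (s * T) * d); first by rewrite mulr_ge0 ?expR_ge0 ?(ltW d0).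
move=> j t tT; have /andP[t0 tT'] := tT.
rewrite normrM normrX (le_trans (ler_wpM2l _ (bnd j t tT)))// ?exprn_ge0//.
rewrite [leLHS](_ : _ = expR (s * t) * (d * (`|lambda| * (d * K)) ^+ j * t `^
  (q - 1))).
  rewrite -!mulrA; apply: ler_pM; rewrite ?expR_ge0//.
  - by rewrite mulr_ge0 ?(ltW d0)// mulr_ge0 ?powR_ge0// exprn_ge0// mulr_ge0.
  - by rewrite ler_expR ler_wpM2l.
  - rewrite ler_wpM2l ?(ltW d0)// ler_wpM2r ?powR_ge0//.
    by rewrite lerXn2r ?nnegrE ?invr_ge0// mulr_ge0.
by rewrite [in RHS]exprMn; ring.
Qed.

End series.

(** * Series of functions dominated by a geometric series *)

Section geometric_series.
Context {R : realType}.
Implicit Types (u : nat -> R -> R) (q t : R).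

Lemma le_series_geometric (v : R^nat) (a : R) :
  (forall j, `|v j| <= a * 2^-1 ^+ j) -> cvgn (series v) /\
  forall n, `|limn (series v) - series v n| <= 2 * a * 2^-1 ^+ n.
Proof.
move=> va.
have cv : cvgn (series v).
  apply: normed_cvg; apply: (series_le_cvg _ _ va).
  - by move=> n; exact: normr_ge0.
  - by move=> n; exact: le_trans (va n).
  - by apply: is_cvg_geometric_series;
      rewrite ger0_norm ?invr_ge0// invf_lt1// ltr1n.
split => // n.
have a0 : 0 <= a by have := le_trans (normr_ge0 _) (va 0%N);
  rewrite expr0 mulr1.
(* The factor [1 - 2^-m] makes the induction on [m] close; the tail estimate follows as [m] tends to
   infinity. *)
have part m : `|series v (n + m)%N - series v n| <= 2 * a * 2^-1 ^+ n * (1 -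
  2^-1 ^+ m).
  elim: m => [|m IH]; first by rewrite addn0 subrr normr0 expr0 subrr mulr0.
  rewrite addnS seriesSr addrAC (le_trans (ler_normD _ _))//.
  rewrite (le_trans (lerD IH (va _)))// exprD exprS le_eqVlt; apply/orP; left.
  by apply/eqP; field.
have cd : (series v (m + n)%N - series v n) @[m --> \oo] -->
    limn (series v) - series v n.
  by apply: cvgB; [rewrite (cvg_shiftn n)|exact: cvg_cst].
have /cvg_norm cdn := cd; rewrite -(cvg_lim _ cdn)//.
apply: limr_le; first exact: cvgP cdn.
apply: nearW => m; rewrite addnC (le_trans (part m))// ler_piMr// ?mulr_ge0
  ?exprn_ge0 ?invr_ge0//.
Qed.

(** The tails are uniformly small on compact subsets of []0, +oo[], which gives continuity, and
    controlled by [t^(q-1)] at the origin, which gives the order. *)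
Lemma Cm1_geometric_series u q : 0 < q <= 1 ->
  (forall j t, 0 < t -> {for t, continuous (u j)}) ->
  (forall T, 0 < T -> exists2 A, 0 <= A & forall j t, 0 < t <= T ->
    `|u j t| <= A * 2^-1 ^+ j * t `^ (q - 1)) ->
  [/\ forall t, 0 < t -> cvgn (series (u ^~ t)),
      Cm1 (fun t => limn (series (u ^~ t))) &
      forall T, 0 < T -> exists2 A, 0 <= A & forall n t, 0 < t <= T ->
        `|limn (series (u ^~ t)) - series (u ^~ t) n| <=
        A * 2^-1 ^+ n * t `^ (q - 1)].
Proof.
move=> q01 cu ub; have /andP[q0 q1] := q01.
have tail T : 0 < T -> exists2 A, 0 <= A & forall t, 0 < t <= T ->
    cvgn (series (u ^~ t)) /\ forall n,
      `|limn (series (u ^~ t)) - series (u ^~ t) n| <= A * 2^-1 ^+ n * t `^ (q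
        - 1).
  move=> T0; have [A A0 uA] := ub T T0; exists (2 * A);
    first by rewrite mulr_ge0.
  move=> t tT; have [|cv tl] := @le_series_geometric (u ^~ t) (A * t `^ (q -
    1)).
    by move=> j; rewrite mulrAC; exact: uA.
  by split => // n; rewrite (le_trans (tl n))// le_eqVlt; apply/orP; left;
    apply/eqP; ring.
have cS n t : 0 < t -> {for t, continuous (fun x => series (u ^~ x) n)}.
  move=> t0; rewrite /series/=; elim: n => [|n IH].
    rewrite (_ : (fun x => _) = (fun=> 0)); first exact: cvg_cst.
    by apply/funext => x; rewrite big_geq.
  rewrite (_ : (fun x => _) = (fun x => \sum_(0 <= k < n) u k x + u n x)).
    by apply: cvgD; [exact: IH|exact: cu].
  by apply/funext => x; rewrite big_nat_recr.
split.
- by move=> t t0; have [A _ tA] := tail t t0; apply: (tA t _).1;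
    rewrite t0 lexx.
- apply/Cm1P; split; last first.
    exists q; split => // T T0; have [A A0 tA] := tail T T0; exists A => t tT.
    (* At [n = 0] the partial sum is empty, so the tail is the whole sum. *)
    by have := (tA t tT).2 0%N;
      rewrite seriesEnat/= big_geq// subr0 expr0 mulr1.
  move=> t t0; have h0 : 0 < t / 2 by rewrite divr_gt0.
  have t20 : 0 < 2 * t by rewrite mulr_gt0.
  have [A A0 tA] := tail _ t20.
  apply/cvgrPdist_le => e e0.
  (* One [n] serves the whole neighbourhood []t/2, 2t[], because [x^(q-1) <= (t/2)^(q-1)] there. *)
  have [n nP] : exists n, A * 2^-1 ^+ n * (t / 2) `^ (q - 1) <= e / 3.
    have : (A * (t / 2) `^ (q - 1)) * 2^-1 ^+ n @[n --> \oo] --> (0 : R).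
      rewrite -[X in _ --> X](mulr0 (A * (t / 2) `^ (q - 1))).
      apply: cvgMr; apply: cvg_expr.
      by rewrite ger0_norm ?invr_ge0// invf_lt1// ltr1n.
    move=> /cvgr0Pnorm_le /(_ (e / 3)) [|N _ /(_ N (leqnn N)) NP].
      by rewrite divr_gt0.
    by exists N; rewrite mulrAC (le_trans (ler_norm _)).
  have bd x : t / 2 < x < 2 * t ->
      `|limn (series (u ^~ x)) - series (u ^~ x) n| <= e / 3.
    move=> /andP[hx xt]; have x0 := lt_trans h0 hx.
    rewrite (le_trans ((tA x _).2 n)) ?x0 ?(ltW xt)//.
    rewrite (le_trans _ nP)// ler_wpM2l ?mulr_ge0 ?exprn_ge0 ?invr_ge0//.
    by rewrite ler_powR_nexp// ltW.
  have /cvgrPdist_le/(_ (e / 3)) cn := cS n t t0.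
  near=> x.
  have -> : limn (series (u ^~ t)) - limn (series (u ^~ x)) =
    (limn (series (u ^~ t)) - series (u ^~ t) n) +
    (series (u ^~ t) n - series (u ^~ x) n) -
    (limn (series (u ^~ x)) - series (u ^~ x) n) by ring.
  have -> : e = e / 3 + e / 3 + e / 3 by field.
  rewrite (le_trans (ler_normB _ _))// lerD//; last first.
    apply: bd; apply/andP; split; near: x; [apply: lt_nbhsr|apply: lt_nbhsl];
      lra.
  rewrite (le_trans (ler_normD _ _))// lerD//; first by apply: bd; lra.
  by near: x; apply: cn; rewrite divr_gt0.
- by move=> T T0; have [A A0 tA] := tail T T0; exists A => // n t tT;
    exact: (tA t tT).2.
Unshelve. all: by end_near. Qed.

End geometric_series.

(** * Convergence and recursion for [lseries] *)

Section convolution_series.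
Context {R : realType}.
Notation conv := (@laplace_conv R).
Variables (kappa : R -> R) (lambda : R).
Hypothesis ck : Cm1 kappa.

(** The term of index [j + 1], so that summation starts at 0; [lseries_psum] at [n.+1] then has the
    first [n] terms. *)
Let u j t := lambda ^+ j * convpow kappa j.+1 t.

Let lseries_psumE t n : lseries_psum kappa lambda t n.+1 = series (u ^~ t) n.
Proof. by rewrite /lseries_psum /series/= big_add1. Qed.

Let geometric : exists2 q, 0 < q <= 1 &
  [/\ forall t, 0 < t -> cvgn (series (u ^~ t)),
      Cm1 (fun t => limn (series (u ^~ t))) &
      forall T, 0 < T -> exists2 A, 0 <= A & forall n t, 0 < t <= T ->
        `|limn (series (u ^~ t)) - series (u ^~ t) n| <=
        A * 2^-1 ^+ n * t `^ (q - 1)].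
Proof.
have [q q01 ub] := convpow_geometric lambda ck; exists q => //.
apply: Cm1_geometric_series q01 _ ub => j t t0.
by apply: Cm1_continuous => //; apply: Cm1Z; exact: Cm1_convpow.
Qed.

Let cvg_psum t : 0 < t ->
  lseries_psum kappa lambda t n @[n --> \oo] --> limn (series (u ^~ t)).
Proof.
move=> t0; have [q _ [cv _ _]] := geometric.
rewrite -cvg_shiftS (_ : (fun n => _) = series (u ^~ t)); first exact: cv.
by apply/funext => n; exact: lseries_psumE.
Qed.

Lemma cvgn_lseries_psum t : 0 < t -> cvgn (lseries_psum kappa lambda t).
Proof. by move=> t0; apply: cvgP; exact: cvg_psum. Qed.

Let lseriesE t : 0 < t -> lseries kappa lambda t = limn (series (u ^~ t)).
Proof. by move=> t0; apply/cvg_lim => //; exact: cvg_psum. Qed.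

Lemma Cm1_lseries : Cm1 (lseries kappa lambda).
Proof.
have [q _ [_ cS _]] := geometric.
by apply: Cm1_eq cS => t t0; rewrite lseriesE.
Qed.

Let series_recr t n : series (u ^~ t) n.+1 = series (u ^~ t) n + u n t.
Proof. by rewrite /series/= big_nat_recr. Qed.

Let Cm1_u j : Cm1 (u j).
Proof. by apply: Cm1Z; exact: Cm1_convpow. Qed.

Let Cm1_series n : Cm1 (fun t => series (u ^~ t) n).
Proof.
elim: n => [|n IH].
  by apply: Cm1_eq (Cm1_cst 0) => t _; rewrite /series/= big_geq.
by apply: Cm1_eq (Cm1D IH (Cm1_u n)) => t _; rewrite series_recr.
Qed.

(** The recursion for partial sums: convolving with [kappa] and multiplying by [lambda] shifts every
    term by one, so only the first term [kappa] is missing. *)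
Let conv_series n t : lambda * conv (fun x => series (u ^~ x) n) kappa t =
  series (u ^~ t) n.+1 - kappa t.
Proof.
elim: n => [|n IH].
  rewrite series_recr {2}/series/= big_geq// add0r /u expr0 mul1r subrr.
  rewrite (eq_laplace_conv (f' := fun x => 0 * 1) (g' := kappa))//.
    rewrite laplace_convZl ?mul0r ?mulr0//; exact: Cm1_cst.
  by move=> x _; rewrite mul0r /series/= big_geq.
rewrite (eq_laplace_conv (f' := fun x => series (u ^~ x) n + u n x) (g' :=
  kappa))//.
rewrite laplace_convDl// mulrDr IH [in RHS]series_recr addrAC;
  congr (_ + _ - _).
rewrite /u laplace_convZl//; last exact: Cm1_convpow.
by rewrite mulrA -exprS convpowS.
Qed.

(** Limit of [conv_series]. It passes under the convolution since the tails are at most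
    [A 2^-n x^(q-1)], whose convolution with [|kappa|] tends to 0. *)
Lemma lseries_rec t : 0 < t -> lseries kappa lambda t =
  kappa t + lambda * conv (lseries kappa lambda) kappa t.
Proof.
move=> t0; have [q /andP[q0 _] [cv cS tail]] := geometric.
pose S x := limn (series (u ^~ x)).
rewrite lseriesE// (eq_laplace_conv (f' := S) (g' := kappa))//.
have [A A0 tA] := tail t t0.
have cq := Cm1_powR (R := R) q0.
pose c := A * conv (fun x => x `^ (q - 1)) (fun x => `|kappa x|) t.
have dist n : `|conv S kappa t - conv (fun x => series (u ^~ x) n) kappa t| <=
    c * 2^-1 ^+ n.
  rewrite -mulN1r -laplace_convZl// -laplace_convDl//; last exact: Cm1Z.
  apply: (@le_trans _ _ (conv (fun x => A * 2^-1 ^+ n * x `^ (q - 1))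
      (fun x => `|kappa x|) t)).
    apply: ler_norm_laplace_conv => //.
    - by apply: Cm1D => //; exact: Cm1Z.
    - exact: Cm1Z.
    - exact: Cm1_norm.
    - by move=> x /andP[x0 xt]; rewrite mulN1r; apply: tA; rewrite x0 ltW.
  rewrite laplace_convZl//; last exact: Cm1_norm.
  by rewrite /c mulrAC.
have c1 : conv (fun x => series (u ^~ x) n) kappa t @[n --> \oo] --> conv S
  kappa t.
  apply/cvgrPdist_le => e e0.
  have : c * 2^-1 ^+ n @[n --> \oo] --> (0 : R).
    rewrite -[X in _ --> X](mulr0 c); apply: cvgMr; apply: cvg_expr.
    by rewrite ger0_norm ?invr_ge0// invf_lt1// ltr1n.
  move=> /cvgr0Pnorm_le /(_ e e0); apply: filterS => n; apply: le_trans.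
  by rewrite (le_trans (dist n))// ler_norm.
have c2 : lambda * conv (fun x => series (u ^~ x) n) kappa t @[n --> \oo] -->
    S t - kappa t.
  under eq_fun do rewrite conv_series.
  by apply: cvgB; [rewrite (cvg_shiftS (series (u ^~ t)));
    exact: cv|exact: cvg_cst].
have c3 : lambda * conv (fun x => series (u ^~ x) n) kappa t @[n --> \oo] -->
    lambda * conv S kappa t by apply: cvgMr.
by rewrite (cvg_unique _ c3 c2)// addrC subrK.
Qed.

End convolution_series.

(** * The initial-value problem *)

Section sonine.
Context {R : realType}.
Notation conv := (@laplace_conv R).
Variables (k kappa : R -> R) (lambda : R).
Hypotheses (ck : Cm1 k) (ckappa : Cm1 kappa) (kappa_k : associate kappa k).

Let l := lseries kappa lambda.
Let cl : Cm1 l. Proof. exact: Cm1_lseries. Qed.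
Let c1 : Cm1 (fun=> 1 : R). Proof. exact: Cm1_cst. Qed.

(** In the convolution of [lseries_rec] with [k], the second term is [l * (kappa * k) = l * 1] up to
    [lambda]. *)
Lemma LseriesE t : 0 < t ->
  Lseries k kappa lambda t = 1 + lambda * conv (fun=> 1) l t.
Proof.
move=> t0; have cll := Cm1_conv cl ckappa.
rewrite /Lseries (eq_laplace_conv (f' := k)
  (g' := fun x => kappa x + lambda * conv l kappa x))//; last first.
  by move=> x x0; exact: lseries_rec.
rewrite laplace_convDr//; last exact: Cm1Z.
rewrite laplace_convZr// laplace_convC// kappa_k//.
rewrite (laplace_convC _ ck cll) laplace_convA//.
rewrite (eq_laplace_conv (f' := l) (g' := fun=> 1))//.
by rewrite laplace_convC.
Qed.

(* Convolving the hypothesis with [l = kappa + lambda (l * kappa)] gives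
   [kappa * w = 0]. *)
Lemma conv_eigen0 (w : R -> R) : Cm1 w ->
  (forall t, 0 < t -> w t = lambda * conv kappa w t) ->
  forall t, 0 < t -> w t = 0.
Proof.
move=> cw wE t t0; have cll := Cm1_conv cl ckappa.
have ckw := Cm1_conv ckappa cw.
suff kw0 x : 0 < x -> conv kappa w x = 0 by rewrite wE// kw0// mulr0.
move=> x0.
have : conv l w x = conv kappa w x + conv l w x; last by lra.
rewrite {1}(eq_laplace_conv (f' := fun x => kappa x + lambda * conv l kappa x)
  (g' := w))//; last by move=> y y0; exact: lseries_rec.
rewrite laplace_convDl//; last exact: Cm1Z.
rewrite laplace_convZl// laplace_convA// -laplace_convZr//.
by congr (_ + _); apply: eq_laplace_conv => // y y0; rewrite -wE.
Qed.

Variables (f : R -> R) (y0 : R).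
Hypothesis hf : Cm1_1 f.

Definition ivp_sol t := conv f l t + y0 * Lseries k kappa lambda t.

Let cf' : Cm1 (f^`())%classic. Proof. by case: hf. Qed.

Let cf : Cm1 f.
Proof.
have [c fE] := Cm1_1_primitive hf.
apply: Cm1_eq (Cm1D (Cm1_cst c) (Cm1_conv c1 cf')) => t t0.
by rewrite fE.
Qed.

Lemma ivp_sol_primitive : exists2 g, Cm1 g &
  forall t, 0 < t -> ivp_sol t = y0 + conv (fun=> 1) g t.
Proof.
have [c fE] := Cm1_1_primitive hf.
have cf'l := Cm1_conv cf' cl.
(* With [f = c + 1 * f'], the first summand is [f * l = 1 * (c l + f' * l)]; [LseriesE] contributes
   [y0 + 1 * (y0 lambda l)]. *)
exists (fun t => c * l t + (conv (f^`())%classic l t + y0 * lambda * l t)).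
  by apply: Cm1D; [exact: Cm1Z|apply: Cm1D => //; exact: Cm1Z].
move=> t t0; rewrite /ivp_sol LseriesE//.
rewrite (eq_laplace_conv (f' := fun x => c * 1 + conv (fun=> 1) (f^`())%classic
  x)
  (g' := l))//; last by move=> x x0; rewrite mulr1 fE.
rewrite laplace_convDl//; [|exact: Cm1Z|exact: Cm1_conv].
rewrite laplace_convZl// laplace_convA//.
rewrite laplace_convDr//; [|exact: Cm1Z|by apply: Cm1D => //; exact: Cm1Z].
rewrite laplace_convZr// laplace_convDr//; last exact: Cm1Z.
rewrite laplace_convZr//.
move: (conv _ l t) (conv _ (conv _ l) t) => a b; ring.
Qed.

Lemma conv_ivp_sol t : 0 < t -> conv k ivp_sol t =
  conv (fun=> 1) (fun x => f x + (y0 * k x + lambda * ivp_sol x)) t.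
Proof.
move=> t0; have ckl := Cm1_conv ck cl; have cfl := Cm1_conv cf cl.
have csol : Cm1 ivp_sol by apply: Cm1D => //; exact: Cm1Z.
have c1l := Cm1_conv c1 cl.
(* [LseriesE] convolved with [h]; it is used for [h = k] and, since [k * (f * l) = f * (k * l)], for
   [h = f]. *)
have klE h x : Cm1 h -> 0 < x -> conv h (conv k l) x =
    conv (fun=> 1) h x + lambda * conv (fun=> 1) (conv h l) x.
  move=> ch x0.
  rewrite (eq_laplace_conv (f' := h) (g' := fun x => 1 + lambda * conv (fun=>
    1) l x))//;
    last by move=> z z0; exact: LseriesE.
  rewrite (laplace_convDr x ch c1 (Cm1Z lambda c1l)).
  by rewrite (laplace_convZr lambda x ch c1l) (laplace_convC x ch c1)
    (laplace_convCA x ch c1 cl).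
rewrite /ivp_sol /Lseries laplace_convDr//; last exact: Cm1Z.
rewrite laplace_convZr// (klE k)//.
rewrite (laplace_convCA t ck cf cl) (klE f)// laplace_convDr//; last first.
  by apply: Cm1D; exact: Cm1Z.
rewrite laplace_convDr//; [|exact: Cm1Z|exact: Cm1Z].
rewrite !laplace_convZr// laplace_convDr//; last exact: Cm1Z.
rewrite laplace_convZr//.
move: (conv _ f t) (conv _ k t) (conv _ (conv f l) t) (conv _ (conv k l) t).
by move=> a b c d; ring.
Qed.

Lemma ivp_sol_cvg : ivp_sol t @[t --> 0^'+] --> y0.
Proof.
have [g cg solE] := ivp_sol_primitive.
have : y0 + conv (fun=> 1) g t @[t --> 0^'+] --> y0 + 0.
  by apply: cvgD; [exact: cvg_cst|exact: cvg_conv1].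
rewrite addr0; apply: cvg_trans.
by apply: near_eq_cvg; near=> t; rewrite solE.
Unshelve. all: by end_near. Qed.

(** The derivative of the candidate is the [g] of [ivp_sol_primitive]; [conv_ivp_sol] gives that of
    [k * y], and the limit [y0] at 0 cancels the term [y0 k]. *)
Lemma ivp_sol_solution : ivp_solution k lambda f y0 ivp_sol.
Proof.
have [g cg solE] := ivp_sol_primitive.
have dsol (t : R) : 0 < t -> is_derive t 1 ivp_sol (g t).
  move=> t0; have h : is_derive t 1 (fun t : R => y0 + conv (fun=> 1) g t) (g
    t).
    have := is_deriveD (is_derive_cst y0 t (1 : R)) (is_derive_conv1 cg t0).
    by rewrite add0r.
  apply: near_eq_is_derive h; near=> x; rewrite solE//.
  by near: x; exact: lt_nbhsr.
split; last exact: ivp_sol_cvg.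
  split=> [t t0|]; first by have [] := dsol t t0.
  by apply: Cm1_eq cg => t t0; rewrite derive1E; have [_ ->] := dsol t t0.
move=> t t0; pose G x := f x + (y0 * k x + lambda * ivp_sol x).
have cG : Cm1 G.
  apply: Cm1D => //; apply: Cm1D; first exact: Cm1Z.
  by apply: Cm1Z; apply: Cm1D; [exact: Cm1_conv|apply: Cm1Z; exact: Cm1_conv].
have [d1 d2] : is_derive t 1 (conv k ivp_sol) (G t).
  apply: near_eq_is_derive (is_derive_conv1 cG t0); near=> x.
  by rewrite conv_ivp_sol//; near: x; exact: lt_nbhsr.
split => //; rewrite /caputo_gfd derive1E d2 /at0.
have /cvg_lim -> // := ivp_sol_cvg.
by rewrite /G; ring.
Unshelve. all: by end_near. Qed.

Lemma ivp_sol_unique z : ivp_solution k lambda f y0 z ->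
  forall t, 0 < t -> z t = ivp_sol t.
Proof.
move=> [z1 zeq zlim].
have [[y1 _] yeq _] := ivp_sol_solution.
have [g cg solE] := ivp_sol_primitive.
have cz' : Cm1 (z^`())%classic by case: z1.
have [c zE] := Cm1_1_primitive z1.
have cE : c = y0.
  have h : c + conv (fun=> 1) (z^`())%classic t @[t --> 0^'+] --> c + 0.
    by apply: cvgD; [exact: cvg_cst|exact: cvg_conv1].
  rewrite addr0 in h; apply: (cvg_unique _ _ zlim) => //.
  apply: cvg_trans h; apply: near_eq_cvg; near=> t.
  by rewrite zE.
have csol : Cm1 ivp_sol.
  by apply: Cm1D; [exact: Cm1_conv|apply: Cm1Z; exact: Cm1_conv].
have cz : Cm1 z.
  apply: Cm1_eq (Cm1D (Cm1_cst c) (Cm1_conv c1 cz')) => t t0.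
  by rewrite zE.
(* The derivative of the difference of the two solutions; the factor [-1] suits the linearity
   lemmas. *)
pose v x := (z^`())%classic x + -1 * g x.
have cv : Cm1 v by apply: Cm1D => //; exact: Cm1Z.
pose w := conv (fun=> 1) v; have cw : Cm1 w by exact: Cm1_conv.
have wE (t : R) : 0 < t -> w t = z t - ivp_sol t.
  move=> t0; rewrite zE// solE// /w laplace_convDr//; last exact: Cm1Z.
  by rewrite laplace_convZr// cE; ring.
(* [k * v] is the derivative of [1 * (k * v) = k * z - k * y]; on subtracting the two equations, the
   terms [y0 k] and [f] cancel. *)
have kv (t : R) : 0 < t -> conv k v t = lambda * w t.
  move=> t0; have ckv := Cm1_conv ck cv.
  have kwE x : conv k z x - conv k ivp_sol x = conv (fun=> 1) (conv k v) x.
    rewrite (laplace_convCA x c1 ck cv) -/w.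
    rewrite (eq_laplace_conv (f := k) (g := w) (f' := k)
      (g' := fun x => z x + -1 * ivp_sol x))//; last first.
      by move=> u u0; rewrite wE// mulN1r.
    rewrite laplace_convDr//; last exact: Cm1Z.
    by rewrite laplace_convZr// mulN1r.
  have [dz ez] := zeq t t0; have [dy ey] := yeq t t0.
  have h1 : is_derive t 1 (conv (fun=> 1) (conv k v))
      ((conv k z)^`()%classic t - (conv k ivp_sol)^`()%classic t).
    rewrite (_ : conv (fun=> 1) (conv k v) = conv k z - conv k ivp_sol).
      exact: is_deriveB (derivable_is_derive1 dz) (derivable_is_derive1 dy).
    by apply/funext => x; rewrite -kwE.
  have h2 := is_derive_conv1 ckv t0.
  have -> : conv k v t = (conv k z)^`()%classic t - (conv k
    ivp_sol)^`()%classic t.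
    by case: h1 => _ <-; case: h2 => _ <-.
  rewrite wE//; move: ez ey; rewrite /caputo_gfd /at0.
  rewrite (cvg_lim _ zlim)// (cvg_lim _ ivp_sol_cvg)//.
  move: (_^`()%classic t) (_^`()%classic t) (z t) (ivp_sol t) (k t) => a b c' d
    e.
  by move=> <- h; lra.
suff w0 (t : R) : 0 < t -> w t = 0.
  by move=> t t0; apply/eqP; rewrite -subr_eq0 -wE// w0.
(* Convolving [k * v = lambda w] with [kappa] gives [1 * v = lambda (kappa * w)], and [1 * v] is
   [w]. *)
apply: conv_eigen0 => // {}t t0.
rewrite -laplace_convZr// (eq_laplace_conv (f' := kappa) (g' := conv k v))//;
  last by move=> x x0; rewrite kv.
rewrite -laplace_convA//.
by apply: eq_laplace_conv => // x x0; rewrite kappa_k.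
Unshelve. all: by end_near. Qed.

End sonine.

Theorem theorem5p1 (R : realType) (k kappa : R -> R)
    (hk : sonine_kernel k) (hkappa : sonine_kernel kappa)
    (hassoc : associate kappa k)
    (lambda y0 : R) (f : R -> R) (hf : Cm1_1 f) :
  [/\ (* existence of a solution, uniqueness, and the representation *)
      exists y : R -> R,
        [/\ ivp_solution k lambda f y0 y,
            forall z : R -> R, ivp_solution k lambda f y0 z ->
              forall t : R, 0 < t -> z t = y t &
            forall t : R, 0 < t ->
              y t = laplace_conv f (lseries kappa lambda) t
                    + y0 * Lseries k kappa lambda t],
      (* the series in l_{kappa,lambda} converges pointwise *)
      forall t : R, 0 < t -> cvgn (lseries_psum kappa lambda t),
      (* so does the series in the second formula for L_{kappa,lambda} *)
      forall t : R, 0 < t ->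
        cvgn (fun n => \sum_(1 <= j < n) lambda ^+ j * convpow kappa j t) &
      (* the second formula for L_{kappa,lambda} *)
      forall t : R, 0 < t ->
        Lseries k kappa lambda t =
        1 + laplace_conv (fun=> 1)
              (fun s => limn (fun n =>
                 \sum_(1 <= j < n) lambda ^+ j * convpow kappa j s)) t].
Proof.
have ck : Cm1 k by case: hk => /Cm10_Cm1.
have ckappa : Cm1 kappa by case: hkappa => /Cm10_Cm1.
have cl := Cm1_lseries lambda ckappa.
(* The index starts at 1, so [lambda * lambda ^+ j.-1] is [lambda ^+ j] throughout. *)
have psumE t : (fun n => \sum_(1 <= j < n) lambda ^+ j * convpow kappa j t) =
    (fun n => lambda * lseries_psum kappa lambda t n).
  apply/funext => n; rewrite /lseries_psum mulr_sumr.
  by apply: eq_big_nat => -[//|j] _; rewrite mulrA -exprS.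
have psum_cvg t : 0 < t -> lambda * lseries_psum kappa lambda t n @[n --> \oo]
  -->
    lambda * lseries kappa lambda t.
  by move=> t0; apply: cvgMr; exact: cvgn_lseries_psum.
split.
- exists (ivp_sol k kappa lambda f y0); split => //.
  + exact: ivp_sol_solution.
  + exact: ivp_sol_unique.
- by move=> t; exact: cvgn_lseries_psum.
- by move=> t t0; rewrite psumE; apply: cvgP; exact: psum_cvg.
- move=> t t0; rewrite LseriesE// -laplace_convZr//; last exact: Cm1_cst.
  congr (_ + _); apply: eq_laplace_conv => // x x0; rewrite psumE.
  by apply/esym/cvg_lim => //; exact: psum_cvg.
Qed.
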